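(* Let $\mathcal{P}$ be a phase space with coordinates $x=(r,y)$, where $r$ are the phase-space coordinates of a reference subsystem and $y$ are the phase-space coordinates of the rest of the system. Let $\mathcal{H}$ be the Hamiltonian constraint that generates the dynamical evolution of the system, i.e. the dynamics is given by $\frac{dx}{d\tau}=\lambda\{x,\mathcal{H}\}$ for an admissible function $\lambda$, with solution $x(\tau,x_0)=(r(\tau,x_0),y(\tau,x_0))$ for the initial condition $x(0,x_0)=x_0$. Let $\Gamma\subset\mathcal{P}$ be a phase-space trajectory generated by $\mathcal{H}$ such that the dynamics of the reference subsystem is injective during this trajectory, i.e. for $x_0\in\Gamma$, $r(\tau,x_0)=r(\tau',x_0)$ implies $\tau=\tau'$. Let $\mathcal{R}=\{r : (r,y)\in\Gamma \text{ for some } y\}$ be the set of values taken by the reference subsystem along $\Gamma$. Then for every $R\in\mathcal{R}$ and every $(r,y)\in\Gamma$ the correlation $Y(R,r,y)$ is well defined as the value that $y$ takes when the reference subsystem takes the value $R$ on the trajectory $\Gamma$, computed from the initial condition $(r,y)$: there is exactly one $\tau\in\mathbb{R}$ with $r(\tau,(r,y))=R$, and $Y(R,r,y):=y(\tau,(r,y))$ for this $\tau$. Moreover, for each fixed $R\in\mathcal{R}$, the function $(r,y)\mapsto Y(R,r,y)$ is constant along $\Gamma$.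
   Context: Setting (temporally diffeomorphism-invariant Hamiltonian systems). The phase space $\mathcal{P}$ is a smooth symplectic manifold with Poisson bracket $\{\cdot,\cdot\}$ (in canonical coordinates $\{f,g\}=\sum_a \frac{\partial f}{\partial q^a}\frac{\partial g}{\partial p_a}-\frac{\partial f}{\partial p_a}\frac{\partial g}{\partial q^a}$), and points are written $x=(r,y)$, with $r$ the (phase-space) coordinates of a chosen reference subsystem (a ''clock'') and $y$ the remaining coordinates; thus $\mathcal{P}=\mathcal{P}_r\times\mathcal{P}_y$. The system has a single constraint, a smooth function $\mathcal{H}$ on $\mathcal{P}$ (the Hamiltonian constraint), and its Hamiltonian is $H_\lambda=\lambda(\tau,x)\mathcal{H}$, where $\lambda$ is an arbitrary function whose choice reflects the freedom of reparametrizing the time parameter $\tau$. The equations of motion are $\frac{dx}{d\tau}=\lambda\{x,\mathcal{H}\}$. The solution with initial condition $x_0$ at $\tau=0$ is $$x(\tau,x_0)=\Phi_{t_\lambda(\tau)}(x_0),\qquad t_\lambda(\tau)=\int_0^\tau\lambda(\tau',x(\tau',x_0))\,d\tau',$$ where $\Phi_t=\exp(t\{\cdot,\mathcal{H}\})$ is the flow of the Hamiltonian vector field of $\mathcal{H}$, i.e. $\frac{d}{dt}\Phi_t(x_0)=\{x,\mathcal{H}\}|_{x=\Phi_t(x_0)}$, $\Phi_0(x_0)=x_0$. The flow is assumed to be defined for all $t\in\mathbb{R}$. The function $\lambda$ is called admissible if it is smooth and positive and, for every $x_0$, $\tau\mapsto t_\lambda(\tau)$ is an increasing bijection of $\mathbb{R}$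 (so that different admissible $\lambda$ give orientation-preserving reparametrizations of the same curve; $\lambda=1$ gives $t_\lambda(\tau)=\tau$). A phase-space trajectory generated by $\mathcal{H}$ is a set $\Gamma=\{x(\tau,x_0):\tau\in\mathbb{R}\}=\{\Phi_t(x_0):t\in\mathbb{R}\}$ for some $x_0\in\mathcal{P}$. Injective temporal evolution: the temporal evolution of a system or subsystem described by a trajectory $x(\tau)$ in phase space, or in a subspace of it, is injective if $x(\tau)=x(\tau')\implies\tau=\tau'$, i.e. the trajectory does not go through the same point more than once. (This property does not depend on which admissible $\lambda$ or which initial point of $\Gamma$ is used.) *)

(* Defs.v *)
From HB Require Import structures.
From mathcomp Require Import all_boot all_order all_algebra.
From mathcomp Require Import all_classical all_reals all_analysis.
Set Implicit Arguments.
Unset Strict Implicit.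
Unset Printing Implicit Defensive.
Import Order.TTheory GRing.Theory Num.Theory.
Import numFieldNormedType.Exports.
Local Open Scope classical_set_scope.
Local Open Scope ring_scope.

Definition partial (R : realType) n (i : 'I_n) (f : 'rV[R]_n -> R)
    (u : 'rV[R]_n) : R := 'D_(delta_mx 0 i) f u.

(* Only meant for open U, as all the differentiability notions below. *)
Fixpoint Ck_on (R : realType) n (k : nat) (U : set 'rV[R]_n)
    (f : 'rV[R]_n -> R) : Prop :=
  (forall u, U u -> {for u, continuous f}) /\
  match k with
  | 0 => True
  | k'.+1 => forall i : 'I_n,
      (forall u, U u -> derivable f u (delta_mx 0 i)) /\
      Ck_on k' U (partial i f)
  end.

Definition smooth_on (R : realType) n (U : set 'rV[R]_n) (f : 'rV[R]_n -> R) :=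
  forall k, Ck_on k U f.

(* A chart is a partial homeomorphism given by two total functions, whose    *)
(* values outside chart_dom and chart_codom are irrelevant.                  *)
Record chart (R : realType) (M : Type) (n : nat) := Chart {
  chart_dom : set M;
  chart_map : M -> 'rV[R]_n;
  chart_inv : 'rV[R]_n -> M
}.

Definition chart_codom (R : realType) (M : Type) n (phi : chart R M n) :
  set 'rV[R]_n := chart_map phi @` chart_dom phi.

Definition coord (R : realType) (M : Type) n (phi : chart R M n) (i : 'I_n)
  (x : M) : R := chart_map phi x 0 i.

Definition is_chart (R : realType) (M : topologicalType) n
    (phi : chart R M n) : Prop :=
  [/\ open (chart_dom phi),
      open (chart_codom phi),
      forall x, chart_dom phi x -> chart_inv phi (chart_map phi x) = x,
      {within chart_dom phi, continuous (chart_map phi)} &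
      {within chart_codom phi, continuous (chart_inv phi)}].

Definition smoothly_compatible (R : realType) (M : Type) n
    (phi psi : chart R M n) : Prop :=
  forall i : 'I_n,
    smooth_on (chart_map phi @` (chart_dom phi `&` chart_dom psi))
              (coord psi i \o chart_inv phi).

(* The atlas is not required to be maximal. *)
Definition is_smooth_manifold (R : realType) (M : topologicalType) n
    (A : set (chart R M n)) : Prop :=
  [/\ hausdorff_space M,
      @second_countable M,
      forall phi, A phi -> is_chart phi,
      forall x, exists2 phi, A phi & chart_dom phi x &
      forall phi psi, A phi -> A psi -> smoothly_compatible phi psi].

Definition smooth_fun (R : realType) (M : Type) n (A : set (chart R M n))
    (f : M -> R) : Prop :=
  forall phi, A phi -> smooth_on (chart_codom phi) (f \o chart_inv phi).

Definition prod_chart (R : realType) (M N : Type) m n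
    (phi : chart R M m) (psi : chart R N n) : chart R (M * N)%type (m + n) :=
  Chart (chart_dom phi `*` chart_dom psi)
        (fun x => row_mx (chart_map phi x.1) (chart_map psi x.2))
        (fun u => (chart_inv phi (lsubmx u), chart_inv psi (rsubmx u))).

Definition prod_atlas (R : realType) (M N : Type) m n
    (A : set (chart R M m)) (B : set (chart R N n)) :
    set (chart R (M * N)%type (m + n)) :=
  [set chi | exists phi psi, [/\ A phi, B psi & chi = prod_chart phi psi]].

Definition line_atlas (R : realType) : set (chart R R 1) :=
  [set Chart setT (fun t : R => const_mx t) (fun u => u 0 0)].

Definition grad (R : realType) (M : Type) n (phi : chart R M n) (f : M -> R)
    (x : M) : 'rV[R]_n :=
  \row_i partial i (f \o chart_inv phi) (chart_map phi x).

Definition jacobian (R : realType) (M : Type) n (phi psi : chart R M n)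
    (x : M) : 'M[R]_n :=
  \matrix_(i, j) grad phi (coord psi i) x 0 j.

(* The symplectic form is given by its components omega phi x i j in every   *)
(* chart phi of the atlas: the covariance law of a 2-form, smoothness,       *)
(* antisymmetry, nondegeneracy and closedness.                               *)
Definition is_symplectic_form (R : realType) (M : Type) n
    (A : set (chart R M n)) (omega : chart R M n -> M -> 'M[R]_n) : Prop :=
  [/\ forall phi psi x, A phi -> A psi ->
        chart_dom phi x -> chart_dom psi x ->
        omega phi x =
          (jacobian phi psi x)^T *m omega psi x *m jacobian phi psi x,
      forall phi i j, A phi ->
        smooth_on (chart_codom phi) (fun u => omega phi (chart_inv phi u) i j),
      forall phi x, A phi -> chart_dom phi x ->
        (omega phi x)^T = - omega phi x,
      forall phi x, A phi -> chart_dom phi x -> omega phi x \in unitmx &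
      forall phi x (i j k : 'I_n), A phi -> chart_dom phi x ->
        let w a b := fun y => omega phi y a b in
        grad phi (w j k) x 0 i + grad phi (w k i) x 0 j
          + grad phi (w i j) x 0 k = 0].

(* The Poisson bracket {f, g} at x, computed in a chart phi around x. The    *)
(* sign is the one for which omega = \sum_a dq^a /\ dp_a in canonical        *)
(* coordinates, see poisson_canonical.                                       *)
Definition poisson (R : realType) (M : Type) n
    (omega : chart R M n -> M -> 'M[R]_n) (phi : chart R M n)
    (f g : M -> R) (x : M) : R :=
  - (grad phi f x *m invmx (omega phi x) *m (grad phi g x)^T) 0 0.

Lemma poisson_canonical (R : realType) (M : Type) n
    (omega : chart R M (n + n) -> M -> 'M[R]_(n + n))
    (phi : chart R M (n + n)) (f g : M -> R) (x : M) :
  omega phi x = block_mx 0 1%:M (- 1%:M) 0 ->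
  let dq (h : M -> R) (a : 'I_n) := grad phi h x 0 (lshift n a) in
  let dp (h : M -> R) (a : 'I_n) := grad phi h x 0 (rshift n a) in
  poisson omega phi f g x = \sum_(a < n) (dq f a * dp g a - dp f a * dq g a).
Proof.
move=> omegaE dq dp; rewrite /poisson omegaE.
set W := block_mx _ _ _ _.
have WW : W *m (- W) = 1%:M.
  rewrite mulmxN mulmx_block !(mulmx0, mul0mx, mul1mx, mulmx1, mulNmx, mulmxN).
  by rewrite !(addr0, add0r) opp_block_mx !oppr0 opprK -scalar_mx_block.
have [Wu _] := mulmx1_unit WW.
have -> : invmx W = - W by rewrite -[LHS]mulmx1 -WW mulKmx.
rewrite -[grad phi f x]hsubmxK -[grad phi g x]hsubmxK.
rewrite mulmxN mulNmx mxE opprK mul_row_block tr_row_mx.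
rewrite !(mulmx0, mulmx1, addr0, add0r, mulmxN) mul_row_col mulNmx.
rewrite !mxE -sumrN -big_split /=; apply: eq_bigr => a _.
by rewrite addrC /dq /dp !mxE.
Qed.

(* The curve c satisfies dx/dtau = lam(tau, x) {x, H}, i.e. this equation    *)
(* holds for all the local coordinates x^i of all the charts.                *)
Definition evolves (R : realType) (M : topologicalType) n
    (A : set (chart R M n)) (omega : chart R M n -> M -> 'M[R]_n)
    (H : M -> R) (lam : R -> M -> R) (c : R -> M) : Prop :=
  continuous c /\
  forall phi tau (i : 'I_n), A phi -> chart_dom phi (c tau) ->
    is_derive tau (1 : R) (fun s => coord phi i (c s))
      (lam tau (c tau) * poisson omega phi (coord phi i) H (c tau)).

Definition is_solution (R : realType) (M : topologicalType) n
    (A : set (chart R M n)) (omega : chart R M n -> M -> 'M[R]_n)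
    (H : M -> R) (lam : R -> M -> R) (x : R -> M -> M) : Prop :=
  forall x0, x 0 x0 = x0 /\ evolves A omega H lam (x ^~ x0).

Definition is_hamiltonian_flow (R : realType) (M : topologicalType) n
    (A : set (chart R M n)) (omega : chart R M n -> M -> 'M[R]_n)
    (H : M -> R) (Phi : R -> M -> M) : Prop :=
  is_solution A omega H (fun _ _ => 1) Phi.

Definition oriented_integral (R : realType) (f : R -> R) (tau : R) : R :=
  if 0 <= tau then (\int[lebesgue_measure]_(s in `[0%R, tau]) f s)%R
  else - (\int[lebesgue_measure]_(s in `[tau, 0%R]) f s)%R.

Definition reparam (R : realType) (M : Type) (lam : R -> M -> R)
    (x : R -> M -> M) (x0 : M) (tau : R) : R :=
  oriented_integral (fun s => lam s (x s x0)) tau.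

(* x is the solution of the equations of motion determined by lam. *)
Definition admissible (R : realType) (M : Type) n (A : set (chart R M n))
    (lam : R -> M -> R) (x : R -> M -> M) : Prop :=
  [/\ smooth_fun (prod_atlas (@line_atlas R) A) (fun p => lam p.1 p.2),
      forall tau p, 0 < lam tau p &
      forall x0, {homo reparam lam x x0 : s t / s < t} /\
                 bijective (reparam lam x x0)].

Definition is_trajectory (R : realType) (M : Type) (Phi : R -> M -> M)
    (Gamma : set M) : Prop :=
  exists x0, Gamma = [set Phi t x0 | t in [set: R]].

Definition clock_values (Pr Py : Type) (Gamma : set (Pr * Py)) : set Pr :=
  [set r | exists y, Gamma (r, y)].

(* get picks an element of the set {tau | r(tau, (r, y)) = r0}; the value    *)
(* is meaningful when this set is a singleton.                               *)
Definition correlation (R : realType) (Pr Py : Type)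
    (x : R -> Pr * Py -> Pr * Py) (r0 r : Pr) (y : Py) : Py :=
  (x (get [set tau : R | (x tau (r, y)).1 = r0]) (r, y)).2.

(* Main.v *)
(* The solution through x0 is x(tau, x0) = Phi_(T tau) x0 with T the
   reparametrization t_lambda: both sides solve c' = a(tau) X_H(c) with
   a(tau) = lambda(tau, x(tau, x0)) and agree at tau = 0. Uniqueness for this
   equation holds because X_H is locally Lipschitz in charts; the set of times
   at which two solutions agree is then open and closed in R. Since T is onto,
   from any point of Gamma the solution reaches every other point of Gamma, in
   particular the point (R, y0) of Gamma; by injectivity of the clock this
   is the only time at which r = R, so Y(R, r, y) = y0 does not depend
   on (r, y). *)
Require Import Defs.
From HB Require Import structures.
From mathcomp Require Import all_boot all_order all_algebra.
From mathcomp Require Import all_classical all_reals all_analysis.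
From mathcomp Require Import ring lra.
Import Order.TTheory GRing.Theory Num.Theory.
Import numFieldNormedType.Exports.
Local Open Scope classical_set_scope.
Local Open Scope ring_scope.

Set Implicit Arguments.
Unset Strict Implicit.
Unset Printing Implicit Defensive.

(** * Locally Lipschitz functions and their stability under algebraic operations *)

Section LocallyLipschitz.
Context {R : realType} {V : normedModType R}.
Implicit Types (f g : V -> R) (u : V).

(** Both points vary in [U], since two solutions will be compared with each other and not only with
    their common value. No sign is imposed on [k], which explains [Num.max k 1] and absolute values
    of constants further on. *)
Definition lip_at f u := exists (k : R) (U : set V),
  nbhs u U /\ forall v w, U v -> U w -> `|f v - f w| <= k * `|v - w|.

Lemma lip_at_near f g u :
  (\forall v \near u, f v = g v) -> lip_at f u -> lip_at g u.
Proof.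
move=> fg [k [U [uU kf]]]; exists k, (U `&` [set v | f v = g v]).
by split=> [|v w [Uv /= <-] [Uw /= <-]]; [exact: filterI|exact: kf].
Qed.

Lemma lip_at_cst (a : R) u : lip_at (cst a) u.
Proof.
exists 0, setT; split=> [|v w _ _]; first exact: filterT.
by rewrite subrr normr0 mul0r.
Qed.

Lemma lip_atN f u : lip_at f u -> lip_at (fun v => - f v) u.
Proof.
move=> [k [U [uU kf]]]; exists k, U; split=> // v w Uv Uw.
by rewrite -opprD normrN; exact: kf.
Qed.

Lemma lip_atD f g u : lip_at f u -> lip_at g u ->
  lip_at (fun v => f v + g v) u.
Proof.
move=> [k [U [uU kf]]] [l [W [uW lg]]]; exists (k + l), (U `&` W).
split=> [|v w [Uv Wv] [Uw Ww]]; first exact: filterI.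
rewrite opprD addrACA mulrDl (le_trans (ler_normD _ _)) // lerD //.
  exact: kf.
exact: lg.
Qed.

Lemma lip_at_sum (I : Type) (s : seq I) (P : pred I) (F : I -> V -> R) u :
  (forall i, P i -> lip_at (F i) u) ->
  lip_at (fun v => \sum_(i <- s | P i) F i v) u.
Proof.
move=> Fu; elim: s => [|i s ih].
  by under eq_fun do rewrite big_nil; exact: lip_at_cst.
under eq_fun do rewrite big_cons.
by case: (boolP (P i)) => // Pi; apply: lip_atD => //; exact: Fu.
Qed.

Lemma lip_at_continuous f u : lip_at f u -> {for u, continuous f}.
Proof.
move=> [k [U [uU kf]]]; apply/cvgrPdist_le => /= e e0.
have k0 : 0 < Num.max k 1 by rewrite lt_max ltr01 orbT.
have d0 : 0 < e / Num.max k 1 by rewrite divr_gt0.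
near=> v.
have Uv : U v by near: v.
apply: le_trans (kf u v (nbhs_singleton uU) Uv) _.
rewrite (@le_trans _ _ (Num.max k 1 * `|u - v|)) //.
  by rewrite ler_wpM2r // le_max lexx.
by rewrite mulrC -ler_pdivlMr //; near: v; exact: cvgr_dist_le.
Unshelve. all: by end_near. Qed.

Lemma lip_at_bounded f u : lip_at f u ->
  \forall v \near u, `|f v| <= `|f u| + 1.
Proof.
move=> /lip_at_continuous/cvgrPdist_le /(_ 1 ltr01); apply: filterS => v.
rewrite distrC => fuv; rewrite -lerBlDl.
by apply: le_trans fuv; exact: lerB_dist.
Qed.

(** The increment of a product splits into two terms, each an increment of one factor times a value
    of the other; these values are bounded near [u] by continuity. *)
Lemma lip_atM f g u : lip_at f u -> lip_at g u ->
  lip_at (fun v => f v * g v) u.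
Proof.
move=> fu gu; have [k [U [uU kf]]] := fu; have [l [W [uW lg]]] := gu.
exists ((`|f u| + 1) * l + (`|g u| + 1) * k).
exists ((U `&` W) `&` [set v | `|f v| <= `|f u| + 1 /\ `|g v| <= `|g u| + 1]).
split=> [|v w [[Uv Wv] [fv _]] [[Uw Ww] [_ gw]]].
  apply: filterI; first exact: filterI.
  by apply: filterI; exact: lip_at_bounded.
have -> : f v * g v - f w * g w = f v * (g v - g w) + g w * (f v - f w) by ring.
rewrite (le_trans (ler_normD _ _)) // !normrM mulrDl -!mulrA lerD // ler_pM //.
  exact: lg.
exact: kf.
Qed.

Lemma lip_at_prod (I : Type) (s : seq I) (P : pred I) (F : I -> V -> R) u :
  (forall i, P i -> lip_at (F i) u) ->
  lip_at (fun v => \prod_(i <- s | P i) F i v) u.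
Proof.
move=> Fu; elim: s => [|i s ih].
  by under eq_fun do rewrite big_nil; exact: lip_at_cst.
under eq_fun do rewrite big_cons.
by case: (boolP (P i)) => // Pi; apply: lip_atM => //; exact: Fu.
Qed.

Lemma lip_atV f u : f u != 0 -> lip_at f u -> lip_at (fun v => (f v)^-1) u.
Proof.
move=> fu0 fu; have [k [U [uU kf]]] := fu.
(* By continuity [a] is a lower bound of [|f|] near [u], so each of the two inverses contributes a
   factor [a^-1] to the constant. *)
set a := `|f u| / 2; have a0 : 0 < a by rewrite divr_gt0 // normr_gt0.
have fa : \forall v \near u, a < `|f v|.
  move: fu => /lip_at_continuous/cvgrPdist_lt /(_ a a0); apply: filterS => v.
  rewrite /a => fuv; have := lerB_dist (f u) (f v); lra.
exists (a^-1 ^+ 2 * k), (U `&` [set v | a < `|f v|]).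
split=> [|v w [Uv /= va] [Uw /= wa]]; first exact: filterI.
have v0 : f v != 0 by rewrite -normr_gt0 (lt_trans a0).
have w0 : f w != 0 by rewrite -normr_gt0 (lt_trans a0).
have -> : (f v)^-1 - (f w)^-1 = (f v)^-1 * (f w)^-1 * (f w - f v).
  by field; rewrite v0 w0.
rewrite !normrM !normfV [`|f w - _|]distrC -[leRHS]mulrA.
rewrite ler_pM ?kf ?mulr_ge0 ?invr_ge0 //.
rewrite expr2 ler_pM ?invr_ge0 // lef_pV2 ?posrE ?normr_gt0 //; exact: ltW.
Qed.

Lemma lip_at_det n (G : V -> 'M[R]_n) u :
  (forall i j, lip_at (fun v => G v i j) u) -> lip_at (fun v => \det (G v)) u.
Proof.
move=> Gu; rewrite /determinant; apply: lip_at_sum => s _.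
by apply: lip_atM; [exact: lip_at_cst|apply: lip_at_prod => i _].
Qed.

(** Cramer's rule: the entries are cofactors divided by the determinant. Invertibility is asked on a
    neighbourhood because [invmx] returns its argument on singular matrices, where this formula
    fails. *)
Lemma lip_at_invmx n (G : V -> 'M[R]_n) u i j :
  (forall i j, lip_at (fun v => G v i j) u) ->
  (\forall v \near u, G v \in unitmx) ->
  lip_at (fun v => invmx (G v) i j) u.
Proof.
move=> Gu unitG.
apply: (@lip_at_near (fun v => (\det (G v))^-1 * cofactor (G v) j i)).
  by apply: filterS unitG => v Gv; rewrite /invmx Gv !mxE.
apply: lip_atM.
  apply: lip_atV; last exact: lip_at_det.
  by rewrite -unitfE; have := nbhs_singleton unitG; rewrite /= unitmxE.
rewrite /cofactor; apply: lip_atM; first exact: lip_at_cst.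
by apply: lip_at_det => k l; under eq_fun do rewrite !mxE.
Qed.

End LocallyLipschitz.

(** * Mean value estimates; C^1 functions are locally Lipschitz *)

Lemma mvt_le {R : realType} (g dg : R -> R) (I : set R) (M : R) :
  is_interval I -> (forall s, I s -> is_derive s 1 g (dg s)) ->
  (forall s, I s -> `|dg s| <= M) ->
  forall a b, I a -> I b -> `|g b - g a| <= M * `|b - a|.
Proof.
move=> itvI Ig dgM.
suff H a b : a <= b -> I a -> I b -> `|g b - g a| <= M * `|b - a|.
  move=> a b Ia Ib; case: (leP a b) => [|/ltW] ab; first exact: H.
  by rewrite distrC [`|b - a|]distrC; exact: H.
move=> ab Ia Ib.
have Iab s : s \in `[a, b]%R -> I s.
  by rewrite in_itv => /=; exact: itvI Ia Ib s.
have Idg s : s \in `]a, b[%R -> is_derive s 1 g (dg s).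
  by move=> sab; apply/Ig/Iab; exact: subset_itv_oo_cc sab.
have gc : {within `[a, b], continuous g}.
  apply: derivable_within_continuous => s sab.
  by have [] := Ig s (Iab s sab).
have [s sab ->] := MVT_segment ab Idg gc.
rewrite normrM ler_wpM2r //; exact/dgM/Iab.
Qed.

Lemma is_derive_line {R : realType} {V : normedModType R} (f : V -> R)
    (p v : V) (s : R) :
  derivable f (p + s *: v) v ->
  is_derive s 1 (fun t => f (p + t *: v)) ('D_v f (p + s *: v)).
Proof.
have E : (fun h : R => h^-1 *: ((fun t => f (p + t *: v)) (h *: 1 + s)
    - f (p + s *: v))) =
  (fun h => h^-1 *: ((f \o shift (p + s *: v)) (h *: v) - f (p + s *: v))).
  apply/funext => h /=; congr (_ *: (f _ - _)).
  by rewrite [h *: 1]mulr1 scalerDl addrCA.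
move=> fv; apply: DeriveDef; last by rewrite /derive /= E.
by rewrite /derivable /= E.
Qed.

Lemma ler_entry_norm {R : realType} m n (A : 'M[R]_(m, n)) i j :
  `|A i j| <= `|A|.
Proof.
rewrite [leRHS]/Num.Def.normr /= mx_normrE.
exact: (le_bigmax _ (fun ij => `|A ij.1 ij.2|) (i, j)).
Qed.

(** Going from [v] to [w] by changing one coordinate at a time, each change is controlled by the
    one-variable mean value inequality, the partial derivatives being bounded near [u] by
    continuity. *)
Lemma Ck_on1_lip_at {R : realType} n (U : set 'rV[R]_n) (f : 'rV[R]_n -> R) u :
  open U -> Ck_on 1 U f -> U u -> lip_at f u.
Proof.
move=> oU [_ f1] Uu.
have [M fM] : exists M, \forall v \near u, forall i, `|partial i f v| <= M.
  exists (\sum_i (`|partial i f u| + 1)).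
  set M := \sum_i _.
  suff H i : \forall v \near u, `|partial i f v| <= M by exact: filter_forall H.
  have := (f1 i).2.1 u Uu => /cvgrPdist_le /(_ 1 ltr01).
  apply: filterS => v; rewrite distrC => fuv.
  rewrite /M (bigD1 i) //= ler_wpDr ?sumr_ge0 //.
  by rewrite -lerBlDl; apply: le_trans fuv; exact: lerB_dist.
have : nbhs u (U `&` [set v | forall i, `|partial i f v| <= M]).
  by apply: filterI => //; exact: open_nbhs_nbhs.
move=> /nbhs_ballP[e /= e0 UM].
exists (\sum_(i < n) M), (ball u e); split; first exact: nbhsx_ballx.
move=> v w [_ uv] [_ uw].
(* [z k] takes the first [k] coordinates from [w] and the others from [v]. *)
pose L (k : nat) (s : R) : 'rV[R]_n :=
  \row_j (if (j < k)%N then w 0 j else if j == k :> nat then s else v 0 j).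
pose z (k : nat) : 'rV[R]_n := \row_j (if (j < k)%N then w 0 j else v 0 j).
have LE (k : 'I_n) s : L k s = L k 0 + s *: delta_mx 0 k.
  apply/rowP => j; rewrite !mxE eqxx /= -val_eqE /=.
  by case: (ltngtP j k) => //= _; rewrite ?mulr0 ?mulr1 ?addr0 ?add0r.
have Lv (k : 'I_n) : L k (v 0 k) = z k.
  apply/rowP => j; rewrite !mxE /=.
  by case: (ltngtP j k) => //= /val_inj ->.
have Lw (k : 'I_n) : L k (w 0 k) = z k.+1.
  apply/rowP => j; rewrite !mxE ltnS /=.
  by case: (ltngtP j k) => //= /val_inj ->.
have zE : f w - f v = \sum_(k < n) (f (z k.+1) - f (z k)).
  rewrite -(big_mkord predT (fun k => f (z k.+1) - f (z k))).
  rewrite telescope_sumr //; congr (f _ - f _); apply/rowP => j; rewrite mxE //.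
  by rewrite ltn_ord.
rewrite distrC zE mulr_suml (le_trans (ler_norm_sum _ _ _)) //.
rewrite ler_sum // => k _.
(* Balls for the maximum norm are boxes, so mixing coordinates of [v], [w] and [s] does not leave
   the ball on which the partial derivatives are bounded. *)
have Lball s : `|u 0 k - s| < e -> ball u e (L k s).
  move=> us; split=> // i j; rewrite mxE ord1.
  case: ifPn => // _; case: ifPn => [/eqP/val_inj ->//|_]; exact: uv.
rewrite -Lw -Lv.
apply: (@le_trans _ _ (M * `|w 0 k - v 0 k|)).
  apply: (@mvt_le _ (fun s => f (L k s)) (fun s => partial k f (L k s))
    [set s | `|u 0 k - s| < e]).
  - move=> a b /=; rewrite !ltr_norml => /andP[? ?] /andP[? ?] c /andP[? ?].
    by rewrite /= ltr_norml; apply/andP; split; lra.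
  - move=> s /= /Lball us; rewrite /partial LE.
    under eq_fun do rewrite LE.
    apply: is_derive_line; rewrite -LE.
    by apply: (f1 k).1; apply: (UM _ us).1.
  - by move=> s /= /Lball us; apply: (UM _ us).2.
  - exact: uv.
  - exact: uw.
rewrite ler_wpM2l //.
  by apply: le_trans (normr_ge0 _) ((UM u _).2 k); exact: ballxx.
by rewrite distrC; have := ler_entry_norm (v - w) 0 k; rewrite !mxE.
Qed.

(** * Local uniqueness for ordinary differential equations *)

Lemma lip_at_uniform {R : realType} {V : normedModType R} n
    (F : 'I_n -> V -> R) u : (forall i, lip_at (F i) u) ->
  exists K : R, 0 <= K /\ exists U : set V, nbhs u U /\
    forall i v w, U v -> U w -> `|F i v - F i w| <= K * `|v - w|.
Proof.
move=> /choice[k /choice[U UP]].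
(* The sum of absolute values dominates every [k i] and is nonnegative whatever their signs. *)
exists (\sum_i `|k i|); split; first exact: sumr_ge0.
exists [set v | forall i, U i v]; split.
  by apply: filter_forall => i; exact: (UP i).1.
move=> i v w Uv Uw; apply: le_trans ((UP i).2 v w (Uv i) (Uw i)) _.
rewrite ler_wpM2r // (bigD1 i) //= (le_trans (ler_norm _)) //.
by rewrite lerDl sumr_ge0.
Qed.

(** In place of Gronwall's inequality, the maximum of [|u1 - u2|] over a short compact interval is
    shown to be at most half of itself. The equations are assumed only near [t0], since a curve may
    leave the chart in which it is read. *)
Lemma ode_unique_near {R : realType} n (F : 'I_n -> 'rV[R]_n -> R) (a : R -> R)
    (u1 u2 : R -> 'rV[R]_n) t0 :
  (forall i, lip_at (F i) (u1 t0)) -> {for t0, continuous a} ->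
  (\forall t \near t0, {for t, continuous u1} /\
    forall i, is_derive t 1 (fun s => u1 s 0 i) (a t * F i (u1 t))) ->
  (\forall t \near t0, {for t, continuous u2} /\
    forall i, is_derive t 1 (fun s => u2 s 0 i) (a t * F i (u2 t))) ->
  u1 t0 = u2 t0 -> \forall t \near t0, u1 t = u2 t.
Proof.
move=> /lip_at_uniform[K [K0 [U [uU KF]]]] ca near1 near2 u12.
have c1 := (nbhs_singleton near1).1; have c2 := (nbhs_singleton near2).1.
have near1U : \forall t \near t0, U (u1 t) by exact: c1.
have near2U : \forall t \near t0, U (u2 t) by apply: c2; rewrite -u12.
have neara : \forall t \near t0, `|a t| <= `|a t0| + 1.
  move: ca => /cvgrPdist_le /(_ 1 ltr01); apply: filterS => t.
  rewrite distrC => h; rewrite -lerBlDl.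
  by apply: le_trans h; exact: lerB_dist.
have [d /= d0 dP] := (nbhs_ballP t0 _).1 (filterI (filterI near1 near2)
  (filterI neara (filterI near1U near2U))).
set B := (`|a t0| + 1) * K.
have B0 : 0 <= B by rewrite mulr_ge0 // addr_ge0.
(* The first bound keeps the closed interval [I] inside the ball of radius [d]; the second gives
   [B * e <= 2^-1], with [B + 1] to allow [B = 0]. *)
pose e := Num.min (d / 2) (2 * (B + 1))^-1.
have e0 : 0 < e by rewrite lt_min divr_gt0 // invr_gt0 mulr_gt0 // ltr_wpDl.
have eB : B * e <= 2^-1.
  apply: (@le_trans _ _ ((B + 1) * (2 * (B + 1))^-1)).
    by rewrite ler_pM ?lerDl ?ge_min ?lexx ?orbT // ltW.
  by rewrite invfM mulrCA divff ?mulr1 // gt_eqF // ltr_wpDl.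
pose I := `[t0 - e, t0 + e]%R.
have It0 : t0 \in I by rewrite in_itv /= lerBlDr lerDl ltW //= lerDl ltW.
have IP t : t \in I -> `|t - t0| <= e.
  by rewrite in_itv /= ler_distlC => /andP[h1 h2]; apply/andP; split; lra.
have Id t : t \in I -> ball t0 d t.
  move=> /IP te; rewrite -ball_normE /= distrC; apply: le_lt_trans te _.
  by rewrite gt_min ltr_pdivrMr // ltr_pMr // ltr1n.
pose D t := u1 t - u2 t.
have Dc : {within [set` I], continuous (fun t => `|D t|)}.
  apply: continuous_in_subspaceT => t /[1!inE] /= /Id/dP[[[h1 _] [h2 _]] _].
  by apply: cvg_norm; exact: cvgB.
have [//|c Ic cmax] := EVT_max _ Dc.
  by rewrite lerD2l ge0_cp // ltW.
have DB i t : t \in I -> `|D t 0 i| <= B * `|D c| * `|t - t0|.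
  move=> tI.
  have -> : D t 0 i = D t 0 i - D t0 0 i.
    by rewrite /D u12 subrr [X in _ = _ - X]mxE subr0.
  apply: (@mvt_le _ (fun t => D t 0 i)
    (fun t => a t * F i (u1 t) - a t * F i (u2 t)) [set` I]) => //.
  - exact: interval_is_interval.
  - move=> s /= /Id/dP[[[_ h1] [_ h2]] _].
    rewrite /D; under eq_fun do rewrite !mxE.
    exact: is_deriveB.
  - move=> s /= /[dup] sI /Id/dP[_ [sa [U1 U2]]].
    rewrite -mulrBr normrM /B -mulrA ler_pM //.
    by apply: le_trans (KF i _ _ U1 U2) _; rewrite ler_wpM2l // cmax.
(* [c] maximizes [|D|] on [I], where [|D| <= B e |D c| <= |D c| / 2]. *)
have Dc0 : `|D c| <= 0.
  suff : `|D c| <= `|D c| / 2 by lra.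
  rewrite [leLHS]/Num.Def.normr /= mx_normrE.
  rewrite bigmax_le ?divr_ge0 // => -[k i] _ /=.
  rewrite ord1; apply: le_trans (DB i c Ic) _.
  rewrite mulrAC mulrC ler_wpM2l //; apply: le_trans eB.
  by rewrite ler_wpM2l // IP.
apply/nbhs_ballP; exists e => // t /= te.
have tI : t \in I.
  move: te; rewrite -ball_normE /= in_itv /= ltr_distlC => /andP[? ?].
  by apply/andP; split; lra.
apply/eqP; rewrite -subr_eq0 -normr_le0.
by apply: le_trans Dc0; exact: cmax.
Qed.

(** * The Hamiltonian vector field and uniqueness of its integral curves *)

Lemma derive_entry {R : realType} m n (i : 'I_m) (j : 'I_n)
    (u v : 'M[R]_(m, n)) :
  'D_v (fun w : 'M[R]_(m, n) => w i j) u =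
  'D_v (fun w : 'M[R]_(m, n) => w i j) 0.
Proof.
pose q (w : 'M[R]_(m, n)) (h : R) :=
  h^-1 *: (((fun w : 'M[R]_(m, n) => w i j) \o shift w) (h *: v) - w i j).
suff E : q u = q 0 by rewrite /derive -/(q u) E.
by apply/funext => h; rewrite /q /= !mxE addrK oppr0 !addr0.
Qed.

(** In a chart, the components of the Hamiltonian vector field are polynomial in constants, entries
    of the inverse of the symplectic matrix and first partial derivatives of [H]. *)
Lemma lip_at_poisson {R : realType} {M : topologicalType} n
    (A : set (chart R M n)) omega (H : M -> R) phi i u :
  is_chart phi -> is_symplectic_form A omega -> smooth_fun A H -> A phi ->
  chart_codom phi u ->
  lip_at (fun v => poisson omega phi (Defs.coord phi i) H (chart_inv phi v)) u.
Proof.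
move=> [_ ocod mapK _ _] [_ somega _ uomega _] sH Aphi codu.
have near_cod : \forall v \near u, chart_codom phi v.
  exact: open_nbhs_nbhs.
have invK v : chart_codom phi v -> chart_map phi (chart_inv phi v) = v.
  by move=> [x dx <-]; rewrite mapK.
have inv_dom v : chart_codom phi v -> chart_dom phi (chart_inv phi v).
  by move=> [x dx <-]; rewrite mapK.
apply: (@lip_at_near _ _ (fun v => - \sum_k (\sum_j
    'D_(delta_mx 0 j) (fun w : 'rV[R]_n => w 0 i) 0 *
    invmx (omega phi (chart_inv phi v)) j k) *
    partial k (H \o chart_inv phi) v)).
  apply: filterS near_cod => v codv; rewrite /poisson mxE; congr (- _).
  apply: eq_bigr => k _; rewrite !mxE invK //; congr (_ * _).
  apply: eq_bigr => j _; rewrite !mxE invK //; congr (_ * _).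
  (* Read in its own chart, a coordinate function is near [v] a linear projection, whose derivative
     is the same at [v] and at 0. *)
  rewrite /partial -(derive_entry _ _ v); apply: near_eq_derive.
  have : \forall w \near v, chart_codom phi w by exact: open_nbhs_nbhs.
  by apply: filterS => w codw /=; rewrite /Defs.coord invK.
apply/lip_atN/lip_at_sum => k _; apply: lip_atM.
  apply: lip_at_sum => j _; apply: lip_atM; first exact: lip_at_cst.
  apply: lip_at_invmx => [k' l|].
    exact: Ck_on1_lip_at ocod (somega phi k' l Aphi 1) codu.
  by apply: filterS near_cod => v /inv_dom; exact: uomega.
(* [H] is taken of class C^2 here so that its first partial derivatives are C^1. *)
exact: Ck_on1_lip_at ocod ((sH phi Aphi 2).2 k).2 codu.
Qed.

Lemma closed_coincidence {S T : topologicalType} (f g : S -> T) :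
  hausdorff_space T -> continuous f -> continuous g ->
  closed [set t | f t = g t].
Proof.
move=> hT cf cg t clt; apply: hT => U W ftU gtW.
have [s [/= fg [Us Ws]]] :=
  clt _ (@filterI _ (nbhs t) _ _ _ (cf t _ ftU) (cg t _ gtW)).
by exists (f s); split=> //; rewrite fg.
Qed.

(** The factor [a] depends on time alone; a factor depending also on the point is brought to this
    form by evaluating it along one fixed solution. *)
Lemma evolves_unique {R : realType} {M : topologicalType} n
    (A : set (chart R M n)) omega (H : M -> R) (a : R -> R) (c1 c2 : R -> M) :
  hausdorff_space M -> (forall phi, A phi -> is_chart phi) ->
  (forall x, exists2 phi, A phi & chart_dom phi x) ->
  is_symplectic_form A omega -> smooth_fun A H -> continuous a ->
  evolves A omega H (fun t _ => a t) c1 ->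
  evolves A omega H (fun t _ => a t) c2 ->
  c1 0 = c2 0 -> c1 = c2.
Proof.
move=> hM chartA coverA sym sH ca [cc1 dc1] [cc2 dc2] c12.
pose E := [set t | c1 t = c2 t].
suff ET : E = setT by apply/funext => t; have : E t by rewrite ET.
have cT : connected [set: R] by apply/connected_intervalP.
apply: cT; first by exists 0.
  exists E; last by rewrite setTI.
  rewrite openE => t0 /= Et0.
  have [phi Aphi domphi] := coverA (c1 t0).
  have [odom _ mapK cmap _] := chartA _ Aphi.
  (* By continuity the curve stays in the chart domain for times near [t0], where its coordinates
     solve an equation in ['rV[R]_n]. *)
  have near_solution c : continuous c ->
      (forall phi tau (i : 'I_n), A phi -> chart_dom phi (c tau) ->
        is_derive tau (1 : R) (fun s => Defs.coord phi i (c s))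
        (a tau * poisson omega phi (Defs.coord phi i) H (c tau))) ->
      chart_dom phi (c t0) ->
      \forall t \near t0, chart_dom phi (c t) /\
        {for t, continuous (chart_map phi \o c)} /\
        forall i, is_derive t 1 (fun s => (chart_map phi \o c) s 0 i)
          (a t * poisson omega phi (Defs.coord phi i) H
             (chart_inv phi ((chart_map phi \o c) t))).
    move=> cc dc domc.
    have : \forall t \near t0, chart_dom phi (c t).
      by apply: cc; apply: open_nbhs_nbhs; split.
    apply: filterS => t domt; split=> //; split.
      apply: continuous_comp; first exact: cc.
      by move: cmap; rewrite continuous_open_subspace //; apply; rewrite inE.
    by move=> i /=; rewrite mapK //; exact: dc.
  have near1 := near_solution c1 cc1 dc1 domphi.
  have domphi2 : chart_dom phi (c2 t0) by rewrite -Et0.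
  have near2 := near_solution c2 cc2 dc2 domphi2.
  have codphi : chart_codom phi ((chart_map phi \o c1) t0) by exists (c1 t0).
  have u12 : (chart_map phi \o c1) t0 = (chart_map phi \o c2) t0.
    by rewrite /= Et0.
  have u12_near : \forall t \near t0,
      (chart_map phi \o c1) t = (chart_map phi \o c2) t.
    apply: (ode_unique_near
      (fun i => lip_at_poisson i (chartA _ Aphi) sym sH Aphi codphi)
      (ca t0) _ _ u12).
      by apply: filterS near1 => t [].
    by apply: filterS near2 => t [].
  near=> t; rewrite /E /=.
  (* Equal coordinates give equal points only inside the chart domain, so both curves must be
     there. *)
  have dom1 : chart_dom phi (c1 t) by near: t; apply: filterS near1 => s [].
  have dom2 : chart_dom phi (c2 t) by near: t; apply: filterS near2 => s [].
  rewrite -(mapK _ dom1) -(mapK _ dom2); congr (chart_inv phi).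
  by near: t.
exists E; last by rewrite setTI.
exact: closed_coincidence.
Unshelve. all: by end_near. Qed.

(** * Differentiation of the reparametrization integral *)

Lemma is_derive_oriented_integral {R : realType} (f : R -> R) (tau : R) :
  continuous f -> is_derive tau (1 : R) (oriented_integral f) (f tau).
Proof.
(* With [a] strictly below both 0 and [tau], both branches of [oriented_integral] equal [G s - G 0]
   for [s] near [tau], so the change of branch at 0 needs no separate treatment. *)
move=> cf; pose a := Num.min 0 tau - 1.
have a0 : a < 0.
  by rewrite /a ltrBlDr (le_lt_trans (_ : _ <= 0)) ?ltr01 // ge_min lexx.
have at_ : a < tau.
  by rewrite /a ltrBlDr (le_lt_trans (_ : _ <= tau)) ?ltrDl // ge_min lexx orbT.
have intf b c : lebesgue_measure.-integrable `[b, c]%classic (EFin \o f).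
  apply: continuous_compact_integrable; first exact: segment_compact.
  exact: continuous_subspaceT.
pose G s := (\int[lebesgue_measure]_(t in `[a, s]) f t)%R.
have GB s t : a < s -> s <= t ->
    G t - G s = (\int[lebesgue_measure]_(x in `[s, t]) f x)%R.
  move=> as_ st; rewrite /G Rintegral_itvB ?bnd_simp //; last exact: ltW.
  rewrite Rintegral_itv_obnd_cbnd //.
  by apply: integrableS (intf s t) => //; exact: subset_itv_oc_cc.
have tau1 : tau < tau + 1 by rewrite ltrDl.
have [dG G'] := continuous_FTC1_closed tau1 (intf a (tau + 1)) at_ (cf tau).
have : is_derive tau (1 : R) (fun s => G s - G 0) (f tau).
  rewrite -[f tau]subr0; apply: is_deriveB.
  by apply: DeriveDef => //; rewrite -derive1E.
apply: near_eq_is_derive.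
near=> s.
have as_ : a < s by near: s; exact: lt_nbhsr.
rewrite /oriented_integral; case: ifPn => [s0|]; first exact: GB.
by rewrite -ltNge => /ltW s0; rewrite -GB // opprB.
Unshelve. all: by end_near. Qed.

(** * Products of Hausdorff spaces and of charts *)

Lemma hausdorff_space_prod {S T : topologicalType} :
  hausdorff_space S -> hausdorff_space T -> hausdorff_space (S * T)%type.
Proof.
move=> hS hT [p1 p2] [q1 q2] pq; congr pair.
  apply: hS => A B pA qB.
  have [[s t] [/= As Bs]] := pq (fst @^-1` A) (fst @^-1` B)
    (cvg_fst pA) (cvg_fst qB).
  by exists s.
apply: hT => A B pA qB.
have [[s t] [/= As Bs]] := pq (snd @^-1` A) (snd @^-1` B)
  (cvg_snd pA) (cvg_snd qB).
by exists t.
Qed.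

Lemma cvg_row_mx {R : realType} {T : Type} (F : set_system T) {FF : Filter F}
    m n (f : T -> 'rV[R]_m) (g : T -> 'rV[R]_n)
    (u : 'rV[R]_m) (v : 'rV[R]_n) :
  f @ F --> u -> g @ F --> v ->
  (fun t => row_mx (f t) (g t)) @ F --> row_mx u v.
Proof.
move=> fu gv.
apply/cvgrPdist_le => /= e e0.
have fe : \forall t \near F, `|u - f t| <= e.
  exact: (cvgrPdist_le _ _).1 fu e e0.
have ge : \forall t \near F, `|v - g t| <= e.
  exact: (cvgrPdist_le _ _).1 gv e e0.
near=> t.
rewrite opp_row_mx add_row_mx.
rewrite [leLHS]/Num.Def.normr /= mx_normrE.
rewrite (bigmax_le _ (ltW e0)) // => -[i j] _ /=.
rewrite mxE; case: (fintype.split j) => k.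
  by apply: le_trans (ler_entry_norm (u - f t) i k) _; near: t.
by apply: le_trans (ler_entry_norm (v - g t) i k) _; near: t.
Unshelve. all: by end_near. Qed.

Lemma chart_codom_prod {R : realType} {M N : Type} m n (phi : chart R M m)
    (psi : chart R N n) :
  chart_codom (prod_chart phi psi) =
  lsubmx @^-1` chart_codom phi `&` rsubmx @^-1` chart_codom psi.
Proof.
apply/seteqP; split=> [w [[x y] [dx dy] <-]|w [[x dx xw] [y dy yw]]] /=.
  by rewrite row_mxKl row_mxKr; split; [exists x|exists y].
by exists (x, y) => //=; rewrite xw yw hsubmxK.
Qed.

Lemma is_chart_prod {R : realType} {M N : topologicalType} m n
    (phi : chart R M m) (psi : chart R N n) :
  is_chart phi -> is_chart psi -> is_chart (prod_chart phi psi).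
Proof.
move=> [od oc mapK cm ci] [od' oc' mapK' cm' ci'].
have oD : open (chart_dom (prod_chart phi psi)).
  rewrite openE => -[x y] [/= dx dy].
  exists (chart_dom phi, chart_dom psi) => //=.
  by split; exact: open_nbhs_nbhs.
have oC : open (chart_codom (prod_chart phi psi)).
  rewrite chart_codom_prod; apply: openI.
    by apply: open_comp => // w _; exact: continuous_lsubmx.
  by apply: open_comp => // w _; exact: continuous_rsubmx.
(* On open sets, continuity within the set is ordinary continuity at its points, which composes with
   the projections. *)
move: cm cm' ci ci'; rewrite !continuous_open_subspace // => cm cm' ci ci'.
split=> //.
- by move=> [x y] [dx dy] /=; rewrite row_mxKl row_mxKr mapK // mapK'.
- rewrite continuous_open_subspace // => -[x y] /[1!inE] -[/= dx dy].
  apply: (@cvg_row_mx _ _ (nbhs (x, y))).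
    apply: (@cvg_comp _ _ _ fst (chart_map phi) (nbhs (x, y)) (nbhs x)).
      exact: cvg_fst.
    by apply: cm; rewrite inE.
  apply: (@cvg_comp _ _ _ snd (chart_map psi) (nbhs (x, y)) (nbhs y)).
    exact: cvg_snd.
  by apply: cm'; rewrite inE.
- rewrite continuous_open_subspace // chart_codom_prod => w.
  move=> /[1!inE] -[/= dl dr].
  apply: (@cvg_pair _ _ _ (nbhs w)).
    apply: (@cvg_comp _ _ _ lsubmx (chart_inv phi) (nbhs w) (nbhs (lsubmx w))).
      exact: continuous_lsubmx.
    by apply: ci; rewrite inE.
  apply: (@cvg_comp _ _ _ rsubmx (chart_inv psi) (nbhs w) (nbhs (rsubmx w))).
    exact: continuous_rsubmx.
  by apply: ci'; rewrite inE.
Qed.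

(** * Change of time along solution curves *)

Lemma evolves_comp {R : realType} {M : topologicalType} n
    (A : set (chart R M n)) omega (H : M -> R) (c : R -> M) (T a : R -> R) :
  evolves A omega H (fun _ _ => 1) c ->
  (forall t : R, is_derive t (1 : R) T (a t)) ->
  evolves A omega H (fun t _ => a t) (c \o T).
Proof.
move=> [cc dc] dT; split.
  move=> t; apply: continuous_comp; last exact: cc.
  have [derT _] := dT t.
  exact/differentiable_continuous/derivable1_diffP.
move=> phi t i Aphi domphi; rewrite mulrC -[X in X * _]mul1r.
exact: (is_derive1_comp (dc phi (T t) i Aphi domphi) (dT t)).
Qed.

(** Needed to differentiate the integral defining [reparam]. Smoothness of [lam] is known only in
    product charts of time and phase space, so the curve [(s, c s)] is followed in such a chart. *)
Lemma continuous_along {R : realType} {M : topologicalType} n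
    (A : set (chart R M n)) (lam : R -> M -> R) (c : R -> M) :
  (forall phi, A phi -> is_chart phi) ->
  (forall x, exists2 phi, A phi & chart_dom phi x) ->
  smooth_fun (prod_atlas (@line_atlas R) A) (fun p => lam p.1 p.2) ->
  continuous c -> continuous (fun s => lam s (c s)).
Proof.
move=> chartA coverA slam cc s0.
have [phi Aphi domphi] := coverA (c s0).
have [odom _ mapK cmap _] := chartA _ Aphi.
pose line := Chart setT (fun t : R => const_mx t) (fun u : 'rV[R]_1 => u 0 0).
pose g s : 'rV[R]_(1 + n) := row_mx (const_mx s) (chart_map phi (c s)).
have codg : chart_codom (prod_chart line phi) (g s0) by exists (s0, c s0).
have clam : {for g s0, continuous
    ((fun p => lam p.1 p.2) \o chart_inv (prod_chart line phi))}.
  by apply: (slam _ _ 0%N).1 codg; exists line, phi.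
have cg : g @ s0 --> g s0.
  apply: cvg_row_mx.
    (* A neighbourhood of a matrix contains a product of neighbourhoods of its entries; here there
       is the single entry [P 0 0]. *)
    move=> W [P Ps PW]; apply: (@filterS _ (nbhs s0) _ (P 0 0)) => [s Pss|].
      by apply: PW => i j; rewrite mxE !ord1.
    by have := Ps 0 0; rewrite mxE.
  apply: (@cvg_comp _ _ _ c (chart_map phi) (nbhs s0) (nbhs (c s0))).
    exact: cc.
  by move: cmap; rewrite continuous_open_subspace //; apply; rewrite inE.
have near_dom : \forall s \near s0, chart_dom phi (c s).
  by apply: cc; apply: open_nbhs_nbhs; split.
have gE s : chart_dom phi (c s) -> lam s (c s) =
    ((fun p => lam p.1 p.2) \o chart_inv (prod_chart line phi)) (g s).
  by move=> dom /=; rewrite row_mxKl row_mxKr mxE mapK.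
rewrite /continuous_at gE //; apply: cvg_trans (cvg_comp _ _ cg clam).
apply: near_eq_cvg; apply: filterS near_dom => s /gE /=.
by move=> <-.
Qed.

(** * Group law of the flow and transitivity of solutions on a trajectory *)

Section Trajectories.
Context {R : realType} {M : topologicalType} {n : nat}.
Context {A : set (chart R M n)} {omega : chart R M n -> M -> 'M[R]_n}.
Context {H : M -> R} {Phi : R -> M -> M}.
Hypotheses (hausdorff_M : hausdorff_space M)
  (chartA : forall phi, A phi -> is_chart phi)
  (coverA : forall x, exists2 phi, A phi & chart_dom phi x)
  (symplectic : is_symplectic_form A omega) (smooth_H : smooth_fun A H)
  (flow_Phi : is_hamiltonian_flow A omega H Phi).

(** As functions of [s], both sides are integral curves with unit factor that start at
    [Phi t x0]. *)
Lemma flowD (s t : R) x0 : Phi (s + t) x0 = Phi s (Phi t x0).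
Proof.
have [Phi0 Phi_evolves] := flow_Phi x0.
have shift_evolves : evolves A omega H (fun _ _ => 1) (fun u => Phi (u + t) x0).
  apply: (evolves_comp (T := fun u => u + t) (a := fun=> 1) Phi_evolves) => u.
  exact: is_derive_shift.
have c1 : continuous (fun _ : R => 1 : R) by exact: cst_continuous.
have := evolves_unique hausdorff_M chartA coverA symplectic smooth_H
  c1 shift_evolves (flow_Phi (Phi t x0)).2.
by move/(_ _)/(congr1 (fun c => c s)); apply; rewrite add0r (flow_Phi _).1.
Qed.

Lemma solution_reparam lam x :
  is_solution A omega H lam x -> admissible A lam x ->
  forall tau x0, x tau x0 = Phi (reparam lam x x0 tau) x0.
Proof.
move=> solx [smooth_lam _ _] tau x0.
have [x00 x_evolves] := solx x0.
(* The factor [a] is [lam] frozen along [x]. Since [evolves] evaluates its factor only on the curve,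
   [x_evolves] is by conversion the equation with factor [a]. *)
have ca := continuous_along chartA coverA smooth_lam x_evolves.1.
have Phi_evolves := evolves_comp (flow_Phi x0).2
  (fun t => is_derive_oriented_integral t ca).
have := evolves_unique hausdorff_M chartA coverA symplectic smooth_H
  ca x_evolves Phi_evolves.
move/(_ _)/(congr1 (fun c => c tau)); apply => /=.
by rewrite x00 /oriented_integral lexx set_itv1 Rintegral_set1 (flow_Phi _).1.
Qed.

Lemma solution_transitive lam x Gamma :
  is_solution A omega H lam x -> admissible A lam x ->
  is_trajectory Phi Gamma ->
  forall p q, Gamma p -> Gamma q -> exists tau, x tau p = q.
Proof.
move=> solx /[dup] adm [_ _ bij] [x0 ->] p q [s _ <-] [t _ <-].
have [T' _ T'K] := (bij (Phi s x0)).2.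
(* The flow needs the time [t - s] to go from [p] to [q]; [T'] converts it to the parameter of the
   solution starting at [p]. *)
exists (T' (t - s)); rewrite (solution_reparam solx adm) T'K -flowD.
by rewrite subrK.
Qed.

End Trajectories.

(** * The product atlas and the correlation *)

Lemma is_chart_prod_atlas {R : realType} {M N : topologicalType} m n
    (A : set (chart R M m)) (B : set (chart R N n)) :
  (forall phi, A phi -> is_chart phi) -> (forall psi, B psi -> is_chart psi) ->
  forall chi, prod_atlas A B chi -> is_chart chi.
Proof.
move=> chartA chartB _ [phi [psi [/chartA ? /chartB ? ->]]].
exact: is_chart_prod.
Qed.

Lemma prod_atlas_cover {R : realType} {M N : Type} m n
    (A : set (chart R M m)) (B : set (chart R N n)) :
  (forall x, exists2 phi, A phi & chart_dom phi x) ->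
  (forall y, exists2 psi, B psi & chart_dom psi y) ->
  forall p, exists2 chi, prod_atlas A B chi & chart_dom chi p.
Proof.
move=> coverA coverB [x y].
have [[phi Aphi dx] [psi Bpsi dy]] := (coverA x, coverB y).
by exists (prod_chart phi psi) => //; exists phi, psi.
Qed.

Unset Implicit Arguments.

Theorem theorem1 (R : realType) (m n : nat) (Pr Py : topologicalType)
    (Ar : set (chart R Pr m)) (Ay : set (chart R Py n))
    (manifold_r : is_smooth_manifold Ar) (manifold_y : is_smooth_manifold Ay)
    (omega : chart R (Pr * Py)%type (m + n) -> Pr * Py -> 'M[R]_(m + n))
    (symplectic : is_symplectic_form (prod_atlas Ar Ay) omega)
    (H : Pr * Py -> R) (smooth_H : smooth_fun (prod_atlas Ar Ay) H)
    (Phi : R -> Pr * Py -> Pr * Py)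
    (flow_Phi : is_hamiltonian_flow (prod_atlas Ar Ay) omega H Phi)
    (lam : R -> Pr * Py -> R) (x : R -> Pr * Py -> Pr * Py)
    (solution_x : is_solution (prod_atlas Ar Ay) omega H lam x)
    (admissible_lam : admissible (prod_atlas Ar Ay) lam x)
    (Gamma : set (Pr * Py)) (trajectory_Gamma : is_trajectory Phi Gamma)
    (injective_r :
       forall x0, Gamma x0 -> injective (fun tau => (x tau x0).1)) :
  forall r0, clock_values Gamma r0 ->
    (forall r y, Gamma (r, y) ->
       (exists! tau, (x tau (r, y)).1 = r0) /\
       (forall tau, (x tau (r, y)).1 = r0 ->
          correlation x r0 r y = (x tau (r, y)).2)) /\
    (forall r y r' y', Gamma (r, y) -> Gamma (r', y') ->
       correlation x r0 r y = correlation x r0 r' y').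
Proof.
have [hausdorff_r _ chart_r cover_r _] := manifold_r.
have [hausdorff_y _ chart_y cover_y _] := manifold_y.
have reach := solution_transitive (hausdorff_space_prod hausdorff_r hausdorff_y)
  (is_chart_prod_atlas chart_r chart_y) (prod_atlas_cover cover_r cover_y)
  symplectic smooth_H flow_Phi solution_x admissible_lam trajectory_Gamma.
move=> r0 [y0 Gamma_r0y0].
(* Existence is obtained for the whole point [(r0, y0)], while uniqueness concerns the clock value
   alone; hence any time showing [r0] also shows [y0]. *)
have unique_time r y : Gamma (r, y) ->
    exists tau, x tau (r, y) = (r0, y0) /\
      forall tau', (x tau' (r, y)).1 = r0 -> tau' = tau.
  move=> Gamma_ry; have [tau xtau] := reach _ _ Gamma_ry Gamma_r0y0.
  exists tau; split=> // tau' xtau'.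
  by apply: (injective_r _ Gamma_ry); rewrite xtau' xtau.
have correlationE r y : Gamma (r, y) -> correlation x r0 r y = y0.
  move=> /unique_time[tau [xtau tau_unique]]; rewrite /correlation.
  set S := [set _ | _].
  (* [get] returns a member of [S] only when [S] is inhabited; [tau] is the witness. *)
  have : S (get S) by apply: getPex; exists tau; rewrite /S /= xtau.
  by move=> /tau_unique ->; rewrite xtau.
split=> [r y Gamma_ry|r y r' y' /correlationE -> /correlationE ->] //.
have [tau [xtau tau_unique]] := unique_time r y Gamma_ry.
split=> [|tau' /tau_unique ->].
  by exists tau; split=> [|tau' /tau_unique->//]; rewrite xtau.
by rewrite xtau correlationE.
Qed.
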